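(* Let $A=(a_1\le\cdots\le a_n)$ be integers with $n\ge2$, $a_1\ge2$, and let $1\le i\le n-1$. Put $A'=(a_1,\ldots,a_{i-1},a_i,\ldots,a_i)$ (with $a_i$ repeated $n-i-1$ times) and $A''=(a_{i+1}-a_i+1,a_{i+2}-a_i+1,\ldots,a_n-a_i+1)$, and regard $S_{i,i+1}(A)$ as a subspace of $M^{A'}\otimes M^{A''}$. Then $S_{i,i+1}(A)$ is a cyclic $\mathcal L_{i-1,n-2}$-module with cyclic vector $v_{A'}\otimes v_{A''}$. If moreover $a_1<\cdots<a_n$ and $a_{j+1}-a_j>1$ for all $j>i$, then, regarding $S_{i,i+1}(A)$ as a subspace of $M^{A_1}\otimes M^{A_2}$, where $A_1=(a_1,\ldots,a_{i-1},a_i+1,a_i+2,\ldots,a_i+n-i-1)$ and $A_2=(a_{i+1}-a_i+1,a_{i+2}-a_i,a_{i+3}-a_i-1,\ldots,a_n-a_i-n+i+2)$, it is a cyclic $\mathcal L_{i-1,n-2}$-module with cyclic vector $v_{A_1}\otimes v_{A_2}$. (This cyclic vector is denoted $v_{i,i+1}(A)$.)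
   Context: Fusion products. Let $e,h,f$ be the standard basis of $\mathfrak{sl}_2(\mathbb C)$ and write $x_j=x\otimes t^j$. For positive integers $A=(a_1,\ldots,a_n)$ choose pairwise distinct $z_1,\ldots,z_n\in\mathbb C$, let $\mathbb C^{a}$ be the $a$-dimensional irreducible $\mathfrak{sl}_2$-module, and $\mathbb C^{a_i}(z_i)$ the $\mathfrak{sl}_2\otimes\mathbb C[t]$-module on which $x_j$ acts as $z_i^jx$. Let $\overline{v_A}\in\bigotimes_i\mathbb C^{a_i}(z_i)$ be the tensor product of lowest weight vectors and $F_s$ the span of all $x^{(1)}_{i_1}\cdots x^{(k)}_{i_k}\overline{v_A}$ with $x^{(j)}\in\mathfrak{sl}_2$, $i_1+\cdots+i_k\le s$. The fusion product is the associated graded $\mathfrak{sl}_2\otimes\mathbb C[t]$-module $M^A=\bigoplus_sF_s/F_{s-1}$, with $v_A$ the image of $\overline{v_A}$ (for the empty sequence $M^{\emptyset}=\mathbb C$, trivial). Known facts: $\mathfrak{sl}_2\otimes t^j$ acts by $0$ for $j\ge n$; $M^A=\mathbb C[e_0,\ldots,e_{n-1}]v_A\simeq\mathbb C[e_0,\ldots,e_{n-1}]/I_A$ with $I_A$ generated by $\sum_{i_1+\cdots+i_k=s}e_{n-1-i_1}\cdots e_{n-1-i_k}$ for $k\ge1$, $s<\sum_{j=1}^n\max(k+1-a_j,0)$ (so $M^A$ does not depend on the $z_i$); $\dim M^A=\prod a_i$. Submodules $S_{i,i+1}(A)$. Let $A_{i,i+1}=(a_1,\ldots,a_{i-1},a_i-1,a_{i+1}+1,a_{i+2},\ldots,a_n)$;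 $S_{i,i+1}(A)$ is the kernel of the surjection of $\mathfrak{sl}_2\otimes\mathbb C[t]$-modules $M^A\to M^{A_{i,i+1}}$, $v_A\mapsto v_{A_{i,i+1}}$. There is an embedding $S_{i,i+1}(A)\hookrightarrow M^{A'}\otimes M^{A''}$ whose image is $\mathbb C[e_0,\ldots,e_{n-3},e^{(2)}_{n-i-1}]\cdot(v_{A'}\otimes v_{A''})$, where $e_j$ acts on the tensor product as $e_j\otimes\mathrm{Id}+\mathrm{Id}\otimes e_j$ and $e^{(2)}_{n-i-1}$ acts as $\mathrm{Id}\otimes e_{n-i-1}$; under the additional hypotheses in the second part of the claim the same is true for $A_1,A_2$ in place of $A',A''$. The Lie algebras. For $0<k\le m$, $\mathcal L_{k,m}=\mathfrak{sl}_2\otimes B_{k,m}$, where $B_{k,m}$ is the commutative graded associative algebra with generators $t$ of degree $1$ and $u$ of degree $m-k$ and relations $t^m=0$, $u^2=0$, $tu=0$. For $k=0$, $\mathcal L_{0,m}=\mathfrak{sl}_2\otimes(\mathbb C[t]/t^{m+1})$. In the action of $\mathcal L_{i-1,n-2}$ on $S_{i,i+1}(A)$, the element $e\otimes t^j$ corresponds to the operator $e_j$ and (for $i\ge2$) $e\otimes u$ to the operator $e^{(2)}_{n-i-1}$.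
   Formalization: In the case i=n-1, n≥3, a_{n-1}<a_n, where the claim is false as stated (e.g. A=(2,2,3), i=2), the relation u^2=0 in B_{i-1,n-2} is replaced by u^2=u. *)

(* Defs.v *)
From HB Require Import structures.
From mathcomp Require Import all_boot all_order all_algebra.
From mathcomp Require Import boolp reals complex.
From mathcomp Require Import ring.

Set Implicit Arguments.
Unset Strict Implicit.
Unset Printing Implicit Defensive.

Import GRing.Theory VectorInternalTheory.
Local Open Scope ring_scope.

Section Span.
Variables (F : fieldType) (V : vectType F).

Lemma vspan_exists (P : V -> Prop) :
  exists U : {vspace V}, (forall w, P w -> w \in U) /\
    (forall W : {vspace V}, (forall w, P w -> w \in W) -> (U <= W)%VS).
Proof.
suff H k (U : {vspace V}) : (\dim {:V} - \dim U <= k)%N ->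
    (forall W : {vspace V}, (forall w, P w -> w \in W) -> (U <= W)%VS) ->
    exists U' : {vspace V}, (forall w, P w -> w \in U') /\
    (forall W : {vspace V}, (forall w, P w -> w \in W) -> (U' <= W)%VS).
  by apply: (H _ 0%VS (leqnn _)) => W _; exact: sub0v.
elim: k U => [|k IHk] U leU minU.
  exists U; split=> // w _; suff -> : U = fullv by rewrite memvf.
  by apply/eqP; rewrite eqEdim subvf -subn_eq0 -leqn0.
have [allU|] := pselect (forall w, P w -> w \in U); first by exists U.
move=> /existsNP[w /not_implyP[Pw /negP wU]].
apply: (IHk (U + <[w]>)%VS); last first.
  by move=> W PW; rewrite subv_add minU //= -memvE PW.
have ltU : (\dim U < \dim (U + <[w]>)%VS)%N.
  rewrite ltn_neqAle dimvS ?addvSl // andbT; apply: contra wU => /eqP eqU.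
  have /eqP -> : U == (U + <[w]>)%VS by rewrite eqEdim addvSl eqU leqnn.
  by rewrite memvE addvSr.
by move: leU; rewrite !leq_subLR addnS => /leq_trans; apply; rewrite -addSn leq_add2r.
Qed.

(* The linear span of an arbitrary, possibly infinite, set of vectors. *)
Definition vspan (P : V -> Prop) : {vspace V} := sval (cid (vspan_exists P)).

(* G . v, where G is the associative unital algebra generated by the set ops *)
Definition opspan (ops : 'End(V) -> Prop) (v : V) : {vspace V} :=
  vspan (fun w => exists2 gs : seq 'End(V),
    (forall g, g \in gs -> ops g) & w = foldr (fun (g : 'End(V)) x => g x) v gs).

End Span.

Section Sl2.
Variables (F : fieldType).

(* For a commutative F-algebra B, the Lie algebra sl_2 (x) B is the Lie       *)
(* algebra sl_2(B) of traceless 2 x 2 matrices over B, the tensor x (x) b     *)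
(* being the matrix b x. A module is given by rho, of which only the values   *)
(* on traceless matrices are meaningful.                                      *)
Definition sl2_rep (B : comAlgType F) (V : vectType F)
    (rho : 'M[B]_2 -> 'End(V)) : Prop :=
  (forall (a : F) (X Y : 'M[B]_2), \tr X = 0 -> \tr Y = 0 ->
     rho (a%:A *: X + Y) = a *: rho X + rho Y) /\
  (forall X Y : 'M[B]_2, \tr X = 0 -> \tr Y = 0 ->
     rho (X *m Y - Y *m X) = (rho X \o rho Y)%VF - (rho Y \o rho X)%VF).

Definition cyclic_vector (B : comAlgType F) (V : vectType F)
    (rho : 'M[B]_2 -> 'End(V)) (v : V) : Prop :=
  opspan (fun g => exists2 X : 'M[B]_2, \tr X = 0 & g = rho X) v = fullv.

Definition sl2e (B : comNzRingType) (b : B) : 'M[B]_2 := b *: delta_mx 0 1.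

(* In the basis w_0, ..., w_(a-1) of C^a, e w_k = w_(k+1),                    *)
(* h w_k = (2 k - (a - 1)) w_k and f w_k = k (a - k) w_(k-1), so that w_0 is  *)
(* a lowest weight vector.                                                    *)
Definition irr_mx (a : nat) (x : 'M[F]_2) : 'M[F]_a :=
  \matrix_(l < a, k < a)
    (x 0 1 *+ (l == k.+1 :> nat)
     + (x 0 0 * (k.*2%:R - a%:R + 1)) *+ (l == k)
     + (x 1 0 * (k * (a - k))%:R) *+ (l.+1 == k :> nat)).

(* A module over sl_2 (x) F[t] together with a distinguished vector.          *)
Record pmod := PMod {
  pcar :> vectType F;
  pact : 'M[{poly F}]_2 -> 'End(pcar);
  pgen : pcar
}.

(* x (x) t^j *)
Definition xt (x : 'M[F]_2) (j : nat) : 'M[{poly F}]_2 :=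
  'X^j *: map_mx polyC x.

Definition evmod (a : nat) (z : F) : pmod :=
  @PMod 'cV[F]_a
    (fun X => linfun (mulmx (irr_mx a (map_mx (horner_eval z) X))))
    (\col_k (k == 0%N :> nat)%:R).

Definition trivmod : pmod := @PMod F^o (fun=> 0) 1.

(* The tensor product of two finite dimensional spaces, in coordinates: the   *)
(* space of matrices, u (x) w being a rank one matrix.                        *)
Definition tensv (U W : vectType F) (u : U) (w : W) : 'M[F]_(dim U, dim W) :=
  (v2r u)^T *m v2r w.

Definition tensf (U W : vectType F) (f : 'End(U)) (g : 'End(W)) :
    'End('M[F]_(dim U, dim W)) :=
  linfun (fun X => (f2mx f)^T *m X *m f2mx g).

Lemma tensfE (U W : vectType F) (f : 'End(U)) (g : 'End(W)) u w :
  tensf f g (tensv u w) = tensv (f u) (g w).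
Proof.
have lin : linear (fun X : 'M[F]_(dim U, dim W) => (f2mx f)^T *m X *m f2mx g).
  by move=> a X Y; rewrite mulmxDr mulmxDl -scalemxAr -scalemxAl.
pose m := GRing.isLinear.Build F _ _ _ _ lin.
pose T : {linear _ -> _} := HB.pack (fun X => (f2mx f)^T *m X *m f2mx g) m.
rewrite /tensf (lfunE T) /= /tensv unlock /= !r2vK trmx_mul !mulmxA.
by [].
Qed.

Definition tens (M N : pmod) : pmod :=
  @PMod 'M[F]_(dim M, dim N)
    (fun X => tensf (pact M X) \1%VF + tensf \1%VF (pact N X))
    (tensv (pgen M) (pgen N)).

Definition evprod (s : seq (nat * F)) : pmod :=
  foldr (fun az M => tens (evmod az.1 az.2) M) trivmod s.

Section Graded.
Variable M : pmod.

Definition fil (s : nat) : {vspace M} :=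
  vspan (fun w => exists2 xs : seq ('M[F]_2 * nat),
    all (fun x => \tr x.1 == 0) xs /\ (\sum_(x <- xs) x.2 <= s)%N &
    w = foldr (fun x y => pact M (xt x.1 x.2) y) (pgen M) xs).

Definition filp (s : nat) : {vspace M} := if s is s'.+1 then fil s' else 0%VS.

(* F_s / F_(s-1) is realized by the complement F_s :\: F_(s-1), the class of  *)
(* w in F_s being its projection cls s w along F_(s-1).                       *)
Definition grc (s : nat) : {vspace M} := (fil s :\: filp s)%VS.
Definition cls (s : nat) : 'End(M) := addv_pi1 (fil s) (filp s).

(* As sl_2 (x) F[t] is generated in degrees 0 and 1, F_s = F_(s+1) implies    *)
(* F_(s+1) = F_(s+2); hence F_s / F_(s-1) = 0 for s >= grN, and the direct    *)
(* sum of the F_s / F_(s-1) is the space of the families indexed by 'I_grN.   *)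
Definition grN : nat := (\dim {:M}).+1.

Lemma cls_eq0 s w : w \in fil s -> (cls s w == 0) = (w \in filp s).
Proof.
move=> Fw; have Fw' : w \in (fil s + filp s)%VS by rewrite (subvP (addvSl _ _)).
have ab := addv_pi1_pi2 Fw'; rewrite -/(cls s) in ab.
have bF : addv_pi2 (fil s) (filp s) w \in filp s by exact: memv_pi2.
apply/eqP/idP=> [c0|wF]; first by rewrite -ab c0 add0r.
have cF : cls s w \in filp s.
  have -> : cls s w = w - addv_pi2 (fil s) (filp s) w by rewrite -{2}ab addrK.
  by rewrite memvB.
have cD : cls s w \in (fil s :\: filp s)%VS by exact: memv_pi.
by apply/eqP; rewrite -memv0 -(capv_diff (fil s) (filp s)) memv_cap cD cF.
Qed.

Definition gr_space : {vspace {ffun 'I_grN -> M}} :=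
  vspan (fun p : {ffun 'I_grN -> M} => forall s : 'I_grN, p s \in grc s).

Definition coef_xt (X : 'M[{poly F}]_2) (j : nat) : 'M[{poly F}]_2 :=
  xt (\matrix_(a, b) (X a b)`_j) j.

Definition gr_act (X : 'M[{poly F}]_2) (p : {ffun 'I_grN -> M}) :
    {ffun 'I_grN -> M} :=
  [ffun s : 'I_grN =>
     cls s (\sum_(r < grN | (r <= s)%N) pact M (coef_xt X (s - r)) (p r))].

Definition gr : pmod :=
  @PMod (subvs_of gr_space)
    (fun X => linfun (fun p => vsproj gr_space (gr_act X (vsval p))))
    (vsproj gr_space
       [ffun s : 'I_grN => if s == 0%N :> nat then cls 0 (pgen M) else 0]).

End Graded.

(* M^A, computed with the evaluation points z; for A = nil this is gr of the  *)
(* trivial module, i.e. the trivial module.                                   *)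
Definition fusion (A : seq nat) (z : seq F) : pmod := gr (evprod (zip A z)).

Definition points (A : seq nat) (z : seq F) : Prop :=
  size z = size A /\ uniq z.

End Sl2.

Arguments pact {F}.
Arguments pgen {F}.

(* The algebra F[t,u]/(t^m, t u, u^2 - q u) for m > 0, as F[t]/(t^m) (+) F u. *)
Definition balg (F : fieldType) (q : bool) (m : nat) : Type :=
  ({poly %/ ('X^m : {poly F})} * F^o)%type.

Section Balg.
Variables (F : fieldType) (q : bool) (m : nat).
Local Notation tpoly := {poly %/ ('X^m : {poly F})}.
Local Notation bext := (balg F q m).

HB.instance Definition _ := GRing.Lmodule.copy bext (tpoly * F^o)%type.

Definition bct (p : tpoly) : F := (p : {poly F})`_0.
Definition bext1 : bext := (1, 0).
Definition bext_mul (x y : bext) : bext :=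
  (x.1 * y.1,
   bct x.1 * (y.2 : F) + (x.2 : F) * bct y.1 + ((x.2 : F) * (y.2 : F)) *+ q).

Local Ltac bring := match goal with |- @eq _ ?a ?b => change (@eq F a b) end;
  case: q; rewrite ?mulr1n ?mulr0n ?addr0; ring.

Lemma bctD : {morph bct : x y / x + y}.
Proof. by move=> x y; rewrite /bct coefD. Qed.

Lemma bctZ a : {morph bct : x / a *: x >-> a * x}.
Proof. by move=> x; rewrite /bct poly_of_qpolyZ coefZ. Qed.

Lemma bct1 : bct 1 = 1.
Proof. by rewrite /bct /= coefC. Qed.

Lemma bctM : {morph bct : x y / x * y}.
Proof.
move=> x y; rewrite /bct poly_of_qpolyM.
have mon := monic_mk_monic ('X^m : {poly F}).
have h0 : (mk_monic ('X^m : {poly F}))`_0 = 0.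
  rewrite /mk_monic monicXn size_polyXn ltnS andbT.
  by case: ltnP => [m0|_]; rewrite ?coefX // coefXn; case: (m) m0.
rewrite -coef0M [in RHS](Pdiv.RingMonic.rdivp_eq mon ((x : {poly F}) * y)).
by rewrite coefD coef0M h0 mulr0 add0r.
Qed.

Fact bext_mulA : associative bext_mul.
Proof.
move=> [x1 x2] [y1 y2] [z1 z2]; rewrite /bext_mul /= !bctM mulrA.
by congr pair; bring.
Qed.

Fact bext_mulC : commutative bext_mul.
Proof.
move=> [x1 x2] [y1 y2]; rewrite /bext_mul /= [x1 * y1]mulrC.
by congr pair; bring.
Qed.

Fact bext_mul1 : left_id bext1 bext_mul.
Proof.
by move=> [x1 x2]; rewrite /bext_mul /= bct1 !mul1r !mul0r mul0rn !addr0.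
Qed.

Fact bext_mulDl : left_distributive bext_mul +%R.
Proof.
move=> [x1 x2] [y1 y2] [z1 z2]; rewrite /bext_mul /= bctD [(_ + _) * z1]mulrDl.
have E (a b c d e g : F) : (a + b) * g + (d + e) * c + ((d + e) * g) *+ q =
    (a * g + d * c + (d * g) *+ q) + (b * g + e * c + (e * g) *+ q) by bring.
by congr pair; exact: E.
Qed.

Fact bext1_neq0 : bext1 != 0.
Proof. by rewrite xpair_eqE oner_eq0. Qed.

HB.instance Definition _ := GRing.Zmodule_isComNzRing.Build bext
  bext_mulA bext_mulC bext_mul1 bext_mulDl bext1_neq0.

Fact bext_scaleAl (a : F) (x y : bext) : a *: (x * y) = (a *: x : bext) * y.
Proof.
case: x y => [x1 x2] [y1 y2]; congr pair; first by rewrite -scalerAl.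
have E (b c d e : F) : a * (b * e + d * c + (d * e) *+ q) =
    (a * b) * e + (a * d) * c + ((a * d) * e) *+ q by bring.
by rewrite /= bctZ; exact: E.
Qed.

HB.instance Definition _ := GRing.Lmodule_isLalgebra.Build F bext bext_scaleAl.
HB.instance Definition _ := GRing.Lalgebra_isComAlgebra.Build F bext.

End Balg.

Section Bkm.
Variable F : fieldType.

(* For q = false this is B_{k,m}. For q = true and 0 < k the relation         *)
(* u^2 = 0 is replaced by u^2 = u (which is homogeneous when k = m, u being   *)
(* then of degree 0); see degenerate below.                                   *)
Definition Bkm (q : bool) (k m : nat) : comAlgType F :=
  if k is 0 then {poly %/ ('X^(m.+1) : {poly F})} else balg F q m.

Definition tB q k m : Bkm q k m :=
  match k return Bkm q k m with
  | 0 => in_qpoly ('X^(m.+1) : {poly F}) 'X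
  | _.+1 => (in_qpoly ('X^m : {poly F}) 'X, 0) : balg F q m
  end.

(* There is no generator u in B_{0,m}; the value for k = 0 is a dummy. *)
Definition uB q k m : Bkm q k m :=
  match k return Bkm q k m with
  | 0 => 0
  | _.+1 => (0, 1) : balg F q m
  end.

Lemma tB_uB q k m (t := tB q k.+1 m.+1) (u := uB q k.+1 m.+1) :
  [/\ t ^+ m.+1 = 0, t * u = 0 & u * u = u *+ q].
Proof.
have mon : ('X^(m.+1) : {poly F}) \is monic by exact: monicXn.
have Xm : mk_monic ('X^(m.+1) : {poly F}) = 'X^(m.+1).
  by rewrite /mk_monic size_polyXn mon.
have tX j : t ^+ j.+1 = (in_qpoly ('X^(m.+1) : {poly F}) 'X ^+ j.+1, 0)
    :> balg F q m.+1.
  elim: j => [|j IH]; first by rewrite !expr1.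
  rewrite exprS IH; congr pair.
  by rewrite /= !mul0r mulr0 mul0rn !addr0.
have ct0 : bct (in_qpoly ('X^(m.+1) : {poly F}) 'X) = 0.
  rewrite /bct /= Xm.
  have := Pdiv.RingMonic.rdivp_eq mon ('X : {poly F}).
  move/(congr1 (fun p : {poly F} => p`_0)).
  by rewrite coefD coef0M coefXn mulr0 add0r coefX => <-.
split.
- rewrite tX; congr pair; rewrite -rmorphXn /=; apply: val_inj => /=.
  by rewrite Xm Pdiv.RingMonic.rmodpp.
- congr pair; first by rewrite mulr0.
  by rewrite /= ct0 !mul0r mul0rn !addr0.
- have ct00 : bct (0 : {poly %/ ('X^(m.+1) : {poly F})}) = 0.
    by rewrite /bct /= coef0.
  rewrite /u /uB /= {t u tX}; case: q; rewrite ?mulr1n ?mulr0n; congr pair;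
  by rewrite /= ?ct00 ?mulr1 ?mulr0 ?mul0r ?add0r.
Qed.

End Bkm.

Section Claim.
Variables (F : fieldType).
Implicit Types (M N : pmod F) (A : seq nat) (z : seq F).

(* a_j with the indexing from 1 used in a_1, ..., a_n *)
Definition ent A (j : nat) : nat := nth 0 A j.-1.

(* A_{i,i+1} *)
Definition seqS (i : nat) A : seq nat :=
  take i.-1 A ++ [:: (ent A i).-1, (ent A i.+1).+1 & drop i.+1 A].

(* A' and A'' *)
Definition seqL (i : nat) A : seq nat :=
  take i.-1 A ++ nseq (size A - i).-1 (ent A i).
Definition seqR (i : nat) A : seq nat :=
  [seq (a - ent A i).+1 | a <- drop i A].

(* A_1 and A_2 *)
Definition seqL1 (i : nat) A : seq nat :=
  take i.-1 A ++ iota (ent A i).+1 (size A - i).-1.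
Definition seqR2 (i : nat) A : seq nat :=
  [seq ((ent A (i.+1 + l)).+1 - (ent A i + l))%N | l <- iota 0 (size A - i)].

Definition pmod_hom M N (f : 'Hom(M, N)) : Prop :=
  forall (X : 'M[{poly F}]_2) w, \tr X = 0 -> f (pact M X w) = pact N X (f w).

(* e_j on M (x) N, i.e. e_j (x) Id + Id (x) e_j, and e^(2)_j on M (x) N *)
Definition eop M N (j : nat) : 'End(tens M N) := pact (tens M N) (sl2e 'X^j).
Definition eop2 M N (j : nat) : 'End(tens M N) :=
  tensf \1%VF (pact N (sl2e 'X^j)).

(* iota embeds S into M (x) N with image                                      *)
(* C[e_0, ..., e_(n-3), e^(2)_(n-i-1)] (v_M (x) v_N)                          *)
Definition embedding (n i : nat) (S : vectType F) M N
    (iota : 'Hom(S, tens M N)) : Prop :=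
  lker iota = 0%VS /\ limg iota = opspan (fun g =>
    (exists2 j : nat, (j < n - 2)%N & g = eop M N j) \/
    g = eop2 M N (n - i - 1)) (pgen (tens M N)).

(* The case where e^(2)_(n-i-1) is e^(2)_0, acts nontrivially, and has to be  *)
(* the action of e (x) u. Since [e^(2)_0, f^(2)_0] = h^(2)_0, the operators   *)
(* x^(2)_0 satisfy the relations of u^2 = u, and no action with u^2 = 0       *)
(* exists: put l = sum (a'_j - 1) + (a_n - a_i). In a finite dimensional      *)
(* module over sl_2 (x) F[u]/(u^2) generated over F[e_0, .., e_(n-3), e (x) u]*)
(* by a lowest weight vector v of weight - l, the nilpotent operator h (x) u  *)
(* kills v, so that (e (x) u) v is killed by f_0 and e_0^(l-1) (e (x) u) v =  *)
(* 0, whereas e_0^(l-1) e^(2)_0 (v_A' (x) v_A'') is not 0.                    *)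
Definition degenerate (n i : nat) A : bool :=
  [&& (2 < n)%N, i == (n - 1)%N & (ent A i < ent A n)%N].

(* S, viewed inside M (x) N through iota, is a cyclic module over             *)
(* sl_2 (x) B_{i-1,n-2} with cyclic vector v_M (x) v_N, e (x) t^j acting as   *)
(* e_j and e (x) u as e^(2)_(n-i-1). For q = false this is L_{i-1,n-2}.       *)
Definition cyclic_Lmod (q : bool) (n i : nat) (S : vectType F) M N
    (iota : 'Hom(S, tens M N)) : Prop :=
  let t := tB F q i.-1 (n - 2) in let u := uB F q i.-1 (n - 2) in
  exists rho : 'M[Bkm F q i.-1 (n - 2)]_2 -> 'End(S),
    [/\ sl2_rep rho,
        forall (j : nat) s, iota (rho (sl2e (t ^+ j)) s) = eop M N j (iota s),
        (2 <= i)%N -> forall s,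
          iota (rho (sl2e u) s) = eop2 M N (n - i - 1) (iota s) &
        exists2 s, iota s = pgen (tens M N) & cyclic_vector rho s].

End Claim.

(* Main.v *)
(* On M (x) N with M, N the two fusion products, let t act by t on both factors
   and u by t^(n-i-1) on the second one. Since sl_2 (x) t^j kills a fusion
   product of length n for j >= n, this factors through B_{i-1,n-2} (with
   u^2 = u in the degenerate case, where t^(n-i-1) = 1). The embedded copy of S
   is generated from the lowest weight vector v (x) v by raising operators, and
   h (x) b, f (x) b map v (x) v to multiples of itself; moving them past the
   raising operators shows that this copy is stable under the whole Lie algebra,
   hence a cyclic module, and the action is carried back to S. *)
From HB Require Import structures.
Require Import Defs.
From mathcomp Require Import all_boot all_order all_algebra.
From mathcomp Require Import boolp reals complex.
From mathcomp Require Import ring zify.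

Set Implicit Arguments.
Unset Strict Implicit.
Unset Printing Implicit Defensive.

Import GRing.Theory VectorInternalTheory.
Local Open Scope ring_scope.

(** * Representations and cyclic vectors *)

Section Span.
Variables (F : fieldType) (V : vectType F).

Lemma mem_vspan (P : V -> Prop) w : P w -> w \in vspan P.
Proof. by rewrite /vspan; case: (cid _) => U [H _] /=; apply: H. Qed.

Lemma vspan_sub (P : V -> Prop) (W : {vspace V}) :
  (forall w, P w -> w \in W) -> (vspan P <= W)%VS.
Proof. by rewrite /vspan; case: (cid _) => U [_ H] /=; apply: H. Qed.

Lemma opspan_gen (ops : 'End(V) -> Prop) v : v \in opspan ops v.
Proof. by apply: mem_vspan; exists [::]. Qed.

Lemma opspan_closed (ops : 'End(V) -> Prop) v g w :
  ops g -> w \in opspan ops v -> g w \in opspan ops v.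
Proof.
move=> og wU; rewrite memv_preim; apply: subvP wU; apply: vspan_sub => x [gs H ->].
rewrite -memv_preim; apply: mem_vspan; exists (g :: gs) => // h.
by rewrite inE => /predU1P[->|/H].
Qed.

Lemma opspan_sub (ops : 'End(V) -> Prop) v (W : {vspace V}) :
  v \in W -> (forall g w, ops g -> w \in W -> g w \in W) ->
  (opspan ops v <= W)%VS.
Proof.
move=> vW H; apply: vspan_sub => w [gs og ->].
elim: gs og => //= g gs IH og; apply: H; first by apply: og; rewrite mem_head.
by apply: IH => h hgs; apply: og; rewrite inE hgs orbT.
Qed.

End Span.

Section Rep.
Variables (F : fieldType) (B : comAlgType F) (V : vectType F).
Variable rho : 'M[B]_2 -> 'End(V).
Hypothesis rep : sl2_rep rho.
Implicit Types X Y : 'M[B]_2.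

Lemma sl2_repZD (a : F) X Y : \tr X = 0 -> \tr Y = 0 ->
  rho (a%:A *: X + Y) = a *: rho X + rho Y.
Proof. by case: rep => H _; exact: H. Qed.

Lemma sl2_repJ X Y : \tr X = 0 -> \tr Y = 0 ->
  rho (X *m Y - Y *m X) = (rho X \o rho Y)%VF - (rho Y \o rho X)%VF.
Proof. by case: rep => _; apply. Qed.

Lemma sl2_repD X Y : \tr X = 0 -> \tr Y = 0 -> rho (X + Y) = rho X + rho Y.
Proof.
by move=> X0 Y0; have := sl2_repZD 1 X0 Y0; rewrite !scale1r.
Qed.

Lemma sl2_rep0 : rho 0 = 0.
Proof.
have := @sl2_repD 0 0 (mxtrace0 _ _) (mxtrace0 _ _); rewrite addr0.
by move/(congr1 (fun f => f - rho 0)); rewrite addrK subrr.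
Qed.

Lemma sl2_repZ (a : F) X : \tr X = 0 -> rho (a%:A *: X) = a *: rho X.
Proof.
by move=> X0; rewrite -[_ *: X]addr0 sl2_repZD ?mxtrace0 // sl2_rep0 addr0.
Qed.

Lemma sl2_rep_sum (I : Type) (r : seq I) (P : pred I) (X : I -> 'M[B]_2) :
  (forall i, \tr (X i) = 0) ->
  rho (\sum_(i <- r | P i) X i) = \sum_(i <- r | P i) rho (X i).
Proof.
move=> X0; have [] // : rho (\sum_(i <- r | P i) X i) =
  \sum_(i <- r | P i) rho (X i) /\ \tr (\sum_(i <- r | P i) X i) = 0.
apply: (big_ind2 (fun x y => rho x = y /\ \tr x = 0)) => //.
- by split; [exact: sl2_rep0|exact: mxtrace0].
- by move=> x _ y _ [<- x0] [<- y0]; rewrite mxtraceD x0 y0 addr0 sl2_repD.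
Qed.

Lemma mxtrace_sl2e (b : B) : \tr (sl2e b) = 0.
Proof.
by rewrite mxtraceZ /mxtrace !big_ord_recl big_ord0 !mxE /= !addr0 mulr0.
Qed.

(* Weaker than being a lowest weight vector: f (x) b need only preserve the line
   of v. *)
Definition lowest (v : V) : Prop :=
  forall X, \tr X = 0 -> X 0 1 = 0 -> rho X v \in <[v]>%VS.

(* Every X is an upper triangular nilpotent matrix plus one fixing the line of
   v, so it is enough to move X past one raising operator at a time. *)
Lemma opspan_stable (ops : 'End(V) -> Prop) (v : V) :
  lowest v ->
  (forall g, ops g -> exists b, g = rho (sl2e b)) ->
  (forall b w, w \in opspan ops v -> rho (sl2e b) w \in opspan ops v) ->
  forall X w, \tr X = 0 -> w \in opspan ops v -> rho X w \in opspan ops v.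
Proof.
move=> lowv opsE stabE.
pose word (gs : seq 'End(V)) := foldr (fun (g : 'End(V)) x => g x) v gs.
have H (gs : seq 'End(V)) : (forall g, g \in gs -> ops g) ->
    word gs \in opspan ops v /\
    forall X, \tr X = 0 -> rho X (word gs) \in opspan ops v.
  elim: gs => [_|g gs IH ogs] /=.
    split=> [|Y Y0]; first exact: opspan_gen.
    have -> : Y = sl2e (Y 0 1) + (Y - sl2e (Y 0 1)) by rewrite addrC subrK.
    have Z0 : \tr (Y - sl2e (Y 0 1)) = 0 by rewrite raddfB /= mxtrace_sl2e Y0 subr0.
    rewrite sl2_repD ?mxtrace_sl2e // add_lfunE memvD //.
      by apply: stabE; exact: opspan_gen.
    have /vlineP[k ->] : rho (Y - sl2e (Y 0 1)) v \in <[v]>%VS.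
      by apply: lowv => //; rewrite !mxE /= mulr1 subrr.
    by rewrite memvZ // opspan_gen.
  have [|wU IHX] := IH; first by move=> h hgs; apply: ogs; rewrite inE hgs orbT.
  have og : ops g by apply: ogs; rewrite mem_head.
  split=> [|Y Y0]; first exact: opspan_closed.
  have [b gE] := opsE g og.
  (* Commuting [Y] past the raising operator [g] leaves [g] applied to [rho Y] of the shorter word,
     plus the bracket acting on that word. The bracket is again traceless, so the induction
     hypothesis, stated for all traceless matrices at once, covers both terms. *)
  have := sl2_repJ Y0 (mxtrace_sl2e b); rewrite -gE => /lfunP.
  move/(_ (word gs)); rewrite add_lfunE opp_lfunE !comp_lfunE => /eqP.
  rewrite eq_sym subr_eq => /eqP ->.
  apply: memvD; last by apply: opspan_closed og _; exact: IHX.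
  by apply: IHX; rewrite raddfB /= mxtrace_mulC subrr.
move=> X w X0; rewrite memv_preim; apply: subvP; apply: vspan_sub => x [gs og ->].
by rewrite -memv_preim; case: (H gs og) => _; apply.
Qed.

End Rep.

(** * Evaluation modules *)

Section Irr.
Variables (F : fieldType) (a : nat).

Let E : 'M[F]_a := \matrix_(l < a, k < a) (l == k.+1 :> nat)%:R.
Let G : 'M[F]_a := \matrix_(l < a, k < a) ((k * (a - k))%:R *+ (l.+1 == k :> nat)).
Let d : 'rV[F]_a := \row_k (k.*2%:R - a%:R + 1).
Let H : 'M[F]_a := diag_mx d.

(** With [E], [H], [G] the matrices of $e$, $h$, $f$, this reduces the bracket identity to the three
    commutation relations proved next. *)
Lemma irr_mxE (x : 'M[F]_2) :
  irr_mx a x = x 0 1 *: E + x 0 0 *: H + x 1 0 *: G.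
Proof.
apply/matrixP=> l k; rewrite !mxE.
rewrite [X in _ = X + _ + _]mulr_natr !mulrnAr; congr (_ + _ + _).
by case: eqP => // ->.
Qed.

Let HE : H *m E = E *m H + 2%:R *: E.
Proof.
apply/matrixP=> l k; rewrite mul_diag_mx mul_mx_diag !mxE.
case: eqP => [->|_]; last by rewrite !(mulr0, mul0r, addr0).
by rewrite doubleS -addn2 natrD; ring.
Qed.

Let HG : H *m G = G *m H - 2%:R *: G.
Proof.
apply/matrixP=> l k; rewrite mul_diag_mx mul_mx_diag !mxE.
case: eqP => [<-|_]; last by rewrite !(mulr0n, mulr0, mul0r, oppr0, addr0).
by rewrite doubleS -addn2 !natrD mulr1n; ring.
Qed.

Let EG : E *m G = G *m E + H.
Proof.
apply/matrixP=> l k; rewrite !mxE.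
have -> : \sum_j E l j * G j k = (k * (a - k))%:R *+ (l == k).
  case: k => [[|k] ltk] /=.
    by rewrite mul0n mul0rn big1 // => j _; rewrite !mxE mulr0n mulr0.
  rewrite (bigD1 (Ordinal (ltnW ltk))) //= big1 ?addr0 => [|j ne]; last first.
    rewrite !mxE /= eqSS; case: (j =P k :> nat) => [jk|]; last by rewrite mulr0n mulr0.
    by case/eqP: ne; apply: val_inj.
  by rewrite !mxE /= eqxx mulr1n mulr_natl -val_eqE.
have -> : \sum_j G l j * E j k = (k.+1 * (a - k.+1))%:R *+ (l == k).
  have [ltk|gek] := ltnP k.+1 a.
    rewrite (bigD1 (Ordinal ltk)) //= big1 ?addr0 => [|j ne]; last first.
      rewrite !mxE /=; case: (j =P k.+1 :> nat) => [jk|]; last by rewrite mulr0.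
      by case/eqP: ne; apply: val_inj.
    by rewrite !mxE /= eqxx mulr1 eqSS val_eqE.
  (* At the highest weight vector, $k = a-1$, there is no index $k+1$ to pass through, and the
     claimed coefficient vanishes as well. *)
  have -> : (a - k.+1)%N = 0%N by lia.
  rewrite muln0 mul0rn big1 // => j _; rewrite !mxE.
  have -> : (j == k.+1 :> nat) = false by have := ltn_ord j; lia.
  by rewrite mulr0.
case: eqP => [->|_]; last by rewrite !mulr0n addr0.
(* The diagonal identity is $k(a-k) = (k+1)(a-k-1) + (2k-a+1)$. *)
have ka := ltn_ord k; rewrite !mulr1n !natrM !natrB // 1?ltnW // -addnn natrD.
by rewrite -addn1 natrD; ring.
Qed.

Lemma irr_mxZD (c : F) (x y : 'M[F]_2) :
  irr_mx a (c *: x + y) = c *: irr_mx a x + irr_mx a y.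
Proof.
rewrite !irr_mxE !mxE; move: E G H => e g h; apply/matrixP=> l k; rewrite !mxE.
by ring.
Qed.

Lemma irr_mxJ (x y : 'M[F]_2) : \tr x = 0 -> \tr y = 0 ->
  irr_mx a (x *m y - y *m x) = irr_mx a x *m irr_mx a y - irr_mx a y *m irr_mx a x.
Proof.
have tr11 (w : 'M[F]_2) : \tr w = 0 -> w 1 1 = - w 0 0.
  rewrite /mxtrace !big_ord_recl big_ord0 addr0 => /eqP.
  rewrite addrC addr_eq0 => /eqP <-; congr (w _ _); exact: val_inj.
move=> /tr11 x11 /tr11 y11; rewrite !irr_mxE.
have M (l k : 'I_2) : (x *m y - y *m x) l k =
    x l 0 * y 0 k + x l 1 * y 1 k - (y l 0 * x 0 k + y l 1 * x 1 k).
  rewrite !mxE !big_ord_recl !big_ord0 !addr0.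
  by have -> : lift 0 0 = 1 :> 'I_2 by exact: val_inj.
rewrite !M !mulmxDl !mulmxDr -!scalemxAl -!scalemxAr HE HG EG x11 y11.
(* Once the relations are used, both sides are linear in the remaining products. These are made
   opaque so that [ring] can compare entries. *)
move: (E *m H) (G *m H) (G *m E) (E *m E) (G *m G) (H *m H) E G H.
move=> {M} m1 m2 m3 m4 m5 m6 e g h; apply/matrixP=> l k; rewrite !mxE.
by ring.
Qed.

End Irr.

Section Modules.
Variable F : fieldType.

Lemma evmod_rep (a : nat) (z : F) : sl2_rep (pact (evmod a z)).
Proof.
have tr0 (X : 'M[{poly F}]_2) : \tr X = 0 -> \tr (map_mx (horner_eval z) X) = 0.
  by move=> X0; rewrite trace_map_mx X0 rmorph0.
split=> [c X Y _ _|X Y /tr0 X0 /tr0 Y0]; apply/lfunP=> w.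
  rewrite add_lfunE scale_lfunE !lfunE /= scalemxAl -mulmxDl -irr_mxZD.
  congr (irr_mx a _ *m w); apply/matrixP=> l k.
  by rewrite !mxE /horner_eval hornerD hornerM hornerZ hornerC mulr1.
rewrite add_lfunE opp_lfunE !comp_lfunE !lfunE /= !mulmxA -mulmxBl -irr_mxJ //.
by rewrite map_mxB !map_mxM.
Qed.

(** A polynomial acts through its value at $z$, which is $0$ on multiples of $t-z$. *)
Lemma evmod_kill (a : nat) (z : F) (X : 'M[{poly F}]_2) :
  (forall l k, 'X - z%:P %| X l k) -> pact (evmod a z) X = 0.
Proof.
move=> dvd; have -> : pact (evmod a z) X = linfun (mulmx (irr_mx a 0)).
  rewrite /=; congr (linfun (mulmx (irr_mx a _))); apply/matrixP=> l k.
  by rewrite !mxE /horner_eval; apply/eqP; have := dvd l k; rewrite dvdp_XsubCl.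
apply/lfunP=> w; rewrite lfunE /= irr_mxE !mxE !scale0r !addr0 mul0mx.
by rewrite zero_lfunE.
Qed.

Lemma evmod_lowest (a : nat) (z : F) :
  lowest (pact (evmod a z)) (pgen (evmod a z)).
Proof.
move=> X _ X01; apply/vlineP; exists ((X 0 0).[z] * (1 - a%:R)).
rewrite /= lfunE /=; apply/colP=> l; rewrite !mxE.
case: a l => [[]//|a] l; rewrite big_ord_recl big1 ?addr0 => [|j _]; last first.
  by rewrite !mxE /= mulr0.
rewrite !mxE /= /horner_eval X01 horner0 mul0rn add0r mulr1 add0r.
by rewrite mul0n addr0 -val_eqE /= mulr_natr [- _ + 1]addrC.
Qed.

(** * Tensor products of representations *)

Section Tensor.
Variables U W : vectType F.

Lemma tensvDl (u u' : U) (w : W) : tensv (u + u') w = tensv u w + tensv u' w.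
Proof. by rewrite /tensv !linearD /= mulmxDl. Qed.

Lemma tensvDr (u : U) (w w' : W) : tensv u (w + w') = tensv u w + tensv u w'.
Proof. by rewrite /tensv !linearD. Qed.

Lemma tensvZl c (u : U) (w : W) : tensv (c *: u) w = c *: tensv u w.
Proof. by rewrite /tensv !linearZ /= -scalemxAl. Qed.

Lemma tensvZr c (u : U) (w : W) : tensv u (c *: w) = c *: tensv u w.
Proof. by rewrite /tensv !linearZ. Qed.

(** Rank one matrices span: each elementary matrix is a tensor of two basis vectors. *)
Lemma tens_ext (f g : 'End('M[F]_(dim U, dim W))) :
  (forall u w, f (tensv u w) = g (tensv u w)) -> f = g.
Proof.
move=> fg; apply/lfunP=> X; rewrite (matrix_sum_delta X) !linear_sum.
apply: eq_bigr => i _; rewrite !linear_sum; apply: eq_bigr => j _.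
rewrite !linearZ /=; congr (_ *: _).
have -> : delta_mx i j = tensv (r2v (delta_mx 0 i) : U) (r2v (delta_mx 0 j) : W).
  by rewrite /tensv !r2vK trmx_delta mul_delta_mx.
exact: fg.
Qed.

(** The formula of [tens], for operators indexed by any type, so that the two factors may later be
    restricted along different maps from $B_{k,m}$. *)
Definition tensor_act (T : Type) (r1 : T -> 'End(U)) (r2 : T -> 'End(W)) X :=
  tensf (r1 X) \1%VF + tensf \1%VF (r2 X).

Lemma tensor_actE T (r1 : T -> 'End(U)) (r2 : T -> 'End(W)) X u w :
  tensor_act r1 r2 X (tensv u w) = tensv (r1 X u) w + tensv u (r2 X w).
Proof. by rewrite add_lfunE !tensfE !id_lfunE. Qed.

Lemma tensf_add0 (T : Type) (r1 : T -> 'End(U)) (r2 : T -> 'End(W)) X :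
  r1 X = 0 -> tensor_act r1 r2 X = tensf \1%VF (r2 X).
Proof.
move=> r0; apply: tens_ext => u w; rewrite tensor_actE tensfE r0 zero_lfunE id_lfunE.
by rewrite -[X in tensv X _](scale0r u) tensvZl scale0r add0r.
Qed.

Lemma tensf0 (f : 'End(U)) : tensf f (0 : 'End(W)) = 0.
Proof.
apply: tens_ext => u w; rewrite tensfE !zero_lfunE.
by rewrite -[X in tensv _ X](scale0r w) tensvZr scale0r.
Qed.

Variables (B : comAlgType F) (r1 : 'M[B]_2 -> 'End(U)) (r2 : 'M[B]_2 -> 'End(W)).

Lemma tensor_rep : sl2_rep r1 -> sl2_rep r2 -> sl2_rep (tensor_act r1 r2).
Proof.
move=> rep1 rep2; split=> [c X Y X0 Y0|X Y X0 Y0]; apply: tens_ext => u w.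
  rewrite [RHS]add_lfunE scale_lfunE !tensor_actE !sl2_repZD // !add_lfunE !scale_lfunE.
  by rewrite tensvDl tensvDr tensvZl tensvZr scalerDr addrACA.
rewrite [RHS]add_lfunE opp_lfunE !comp_lfunE !tensor_actE !linearD /= !tensor_actE.
rewrite !sl2_repJ // !add_lfunE !opp_lfunE !comp_lfunE -!scaleN1r.
rewrite tensvDl tensvDr tensvZl tensvZr !scaleN1r.
set x1 := tensv (r1 X (r1 Y u)) w; set x2 := tensv (r1 Y (r1 X u)) w.
set x3 := tensv u _; set x4 := tensv u _.
by rewrite !opprD addrACA; apply/matrixP=> l k; rewrite !mxE; ring.
Qed.

Lemma tensor_lowest u w :
  lowest r1 u -> lowest r2 w -> lowest (tensor_act r1 r2) (tensv u w).
Proof.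
move=> l1 l2 X X0 X01; rewrite tensor_actE.
have /vlineP[c ->] := l1 X X0 X01; have /vlineP[d ->] := l2 X X0 X01.
by rewrite tensvZl tensvZr -scalerDl memvZ ?memv_line.
Qed.

End Tensor.

Lemma trivmod_rep : sl2_rep (pact (trivmod F)).
Proof.
split=> [c X Y _ _|X Y _ _]; apply/lfunP=> w /=.
  by rewrite scaler0 addr0.
by rewrite subrr zero_lfunE.
Qed.

Lemma evprod_rep s : sl2_rep (pact (evprod s : pmod F)).
Proof.
elim: s => [|az s IH]; first exact: trivmod_rep.
exact: tensor_rep (evmod_rep _ _) IH.
Qed.

Lemma evprod_lowest s : lowest (pact (evprod s)) (pgen (evprod s : pmod F)).
Proof.
elim: s => [X _ _|az s IH]; first by rewrite zero_lfunE mem0v.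
exact: tensor_lowest (evmod_lowest _ _) IH.
Qed.

Lemma evprod_kill (s : seq (nat * F)) (X : 'M[{poly F}]_2) :
  (forall l k, \prod_(az <- s) ('X - az.2%:P) %| X l k) ->
  pact (evprod s) X = 0.
Proof.
elim: s => // az s IH dvd.
rewrite [LHS](_ : _ = tensor_act (pact (evmod az.1 az.2)) (pact (evprod s)) X) //.
rewrite tensf_add0 ?evmod_kill ?IH ?tensf0 // => l k;
  apply: dvdp_trans (dvd l k); rewrite big_cons ?dvdp_mulIl ?dvdp_mulIr //.
Qed.

(** $\mathbb C^1$ is the trivial module: its only weight is $2\cdot 0-1+1=0$. *)
Lemma evprod1_kill (z : F) (X : 'M[{poly F}]_2) : pact (evprod [:: (1%N, z)]) X = 0.
Proof.
rewrite [LHS](_ : _ = tensor_act (pact (evmod 1 z)) (pact (trivmod F)) X) //.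
rewrite tensf_add0 ?tensf0 //.
have -> : pact (evmod 1 z) X = linfun (mulmx (0 : 'M_1)).
  congr (linfun (mulmx _)); apply/matrixP=> l k; rewrite !ord1 !mxE /=.
  by rewrite sub0r addNr mulr0 mul0rn mul0n mulr0 !mulr0n !addr0.
by apply/lfunP=> w; rewrite lfunE /= mul0mx zero_lfunE.
Qed.

End Modules.

(** * Associated graded modules *)

Section Coefficients.
Variable F : fieldType.
Implicit Types (x y : 'M[F]_2) (X Y : 'M[{poly F}]_2).

Lemma mxtrace_xt x j : \tr x = 0 -> \tr (xt x j) = 0.
Proof. by move=> x0; rewrite mxtraceZ trace_map_mx x0 rmorph0 mulr0. Qed.

Definition coef_mx X j : 'M[F]_2 := \matrix_(l, k) (X l k)`_j.

Lemma mxtrace_coef_mx X j : \tr X = 0 -> \tr (coef_mx X j) = 0.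
Proof.
move=> X0; rewrite -(coef0 F j) -X0 coef_sum.
by apply: eq_bigr => l _; rewrite mxE.
Qed.

Lemma coef_mxZD c X Y j : coef_mx (c%:A *: X + Y) j = c *: coef_mx X j + coef_mx Y j.
Proof. by apply/matrixP=> l k; rewrite !mxE coefD mulr_algl coefZ. Qed.

Lemma coef_mxM X Y j :
  coef_mx (X *m Y) j = \sum_(a < j.+1) coef_mx X a *m coef_mx Y (j - a).
Proof.
apply/matrixP=> l k; rewrite summxE !mxE coef_sum.
under [RHS]eq_bigr do rewrite mxE.
rewrite exchange_big /=; apply: eq_bigr => h _.
by rewrite coefM; apply: eq_bigr => a _; rewrite !mxE.
Qed.

Lemma coef_mxMr X Y j :
  coef_mx (X *m Y) j = \sum_(a < j.+1) coef_mx X (j - a) *m coef_mx Y a.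
Proof.
rewrite coef_mxM (reindex_inj rev_ord_inj); apply: eq_bigr => a _ /=.
by rewrite subSS subKn // -ltnS.
Qed.

Lemma xtM x y j k : xt x j *m xt y k = xt (x *m y) (j + k).
Proof. by rewrite /xt -scalemxAl -scalemxAr scalerA -exprD map_mxM. Qed.

Lemma xtZD c x y j : xt (c *: x + y) j = c%:A *: xt x j + xt y j.
Proof.
apply/matrixP=> l k; rewrite !mxE polyCD polyCM mulrDr mulrCA; congr (_ + _).
by rewrite alg_polyC.
Qed.

Lemma xtB x y j : xt (x - y) j = xt x j - xt y j.
Proof. by apply/matrixP=> l k; rewrite !mxE polyCB mulrBr. Qed.

Lemma xt_sum (I : Type) (r : seq I) (P : pred I) (x : I -> 'M[F]_2) j :
  xt (\sum_(i <- r | P i) x i) j = \sum_(i <- r | P i) xt (x i) j.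
Proof.
by rewrite /xt map_mx_sum scaler_sumr.
Qed.

(** The Cauchy product is expanded in opposite orders for the two terms, so that both pair degree
    $j-a$ of [X] with degree $a$ of [Y] and combine into brackets. *)
Lemma coef_xtJ X Y j :
  coef_xt (X *m Y - Y *m X) j = \sum_(a < j.+1)
    (coef_xt X (j - a) *m coef_xt Y a - coef_xt Y a *m coef_xt X (j - a)).
Proof.
have -> : coef_xt (X *m Y - Y *m X) j =
    xt (coef_mx (X *m Y) j - coef_mx (Y *m X) j) j.
  by congr xt; apply/matrixP=> l k; rewrite !mxE coefB.
rewrite coef_mxMr coef_mxM -sumrB xt_sum; apply: eq_bigr => a _.
have aj : (a <= j)%N by rewrite -ltnS.
by rewrite /coef_xt !xtM subnK // subnKC // -xtB.
Qed.

End Coefficients.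

Section Graded.
Variables (F : fieldType) (M : pmod F).
Hypothesis rep : sl2_rep (pact M).
Implicit Types (x : 'M[F]_2) (X Y : 'M[{poly F}]_2) (w : M).

Lemma filS s t : (s <= t)%N -> (fil M s <= fil M t)%VS.
Proof.
move=> st; apply: vspan_sub => w [xs [tr0 le] ->]; apply: mem_vspan; exists xs => //.
by split=> //; exact: leq_trans st.
Qed.

Lemma fil_gen : pgen M \in fil M 0.
Proof. by apply: mem_vspan; exists [::] => //; rewrite big_nil. Qed.

Lemma fil_act x j s t w :
  \tr x = 0 -> (s + j <= t)%N -> w \in fil M s -> pact M (xt x j) w \in fil M t.
Proof.
move=> x0 le; rewrite memv_preim; apply: subvP; apply: vspan_sub => y [xs [tr0 leS] ->].
rewrite -memv_preim; apply: mem_vspan; exists ((x, j) :: xs) => //.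
by rewrite /= x0 eqxx tr0 big_cons; split=> //=; lia.
Qed.

Lemma filp_fil s : (filp M s <= fil M s)%VS.
Proof. by case: s => [|s]; [exact: sub0v|exact: filS]. Qed.

Lemma filp_lt s t : (s < t)%N -> (fil M s <= filp M t)%VS.
Proof. by case: t => // t st; exact: filS. Qed.

Lemma filp_act x j s t w :
  \tr x = 0 -> (s + j <= t)%N -> w \in filp M s -> pact M (xt x j) w \in filp M t.
Proof.
case: s => [|s] x0 le wF; last first.
  by apply: subvP (fil_act x0 (leqnn _) wF); apply: filp_lt.
by move: wF; rewrite memv0 => /eqP ->; rewrite linear0 mem0v.
Qed.

Lemma cls_grc s w : cls M s w \in grc M s.
Proof. exact: memv_pi. Qed.

Lemma grc_fil s : (grc M s <= fil M s)%VS.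
Proof. exact: diffvSl. Qed.

Lemma sub_cls s w : w \in fil M s -> w - cls M s w \in filp M s.
Proof.
move=> Fw; have Fw' : w \in (fil M s + filp M s)%VS by rewrite (subvP (addvSl _ _)).
by rewrite -{1}(addv_pi1_pi2 Fw') [_ + _ - _]addrC addKr memv_pi2.
Qed.

(** The graded action is well defined: replacing [w] by its representative changes it by an element
    of $F_{r-1}$, which $x_j$ sends into $F_{s-1}$, the part killed by [cls M s]. *)
Lemma cls_act x j r s w : \tr x = 0 -> (r + j)%N = s -> w \in fil M r ->
  cls M s (pact M (xt x j) (cls M r w)) = cls M s (pact M (xt x j) w).
Proof.
move=> x0 rj Fw; apply/eqP; rewrite eq_sym -subr_eq0 -!linearB /=.
have h : pact M (xt x j) (w - cls M r w) \in filp M s.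
  by apply: filp_act (sub_cls Fw); rewrite ?rj.
by rewrite cls_eq0 // (subvP (filp_fil s)).
Qed.

(** Evaluation at [s] is linear, so the families with components in [grc] already form a subspace
    and taking their span adds nothing. *)
Lemma gr_spaceP (p : {ffun 'I_(grN M) -> M}) :
  reflect (forall s, p s \in grc M s) (p \in gr_space M).
Proof.
apply: (iffP idP) => [pG s|]; last by move=> pG; apply: mem_vspan.
have lin : linear (fun p : {ffun 'I_(grN M) -> M} => p s).
  by move=> c p1 p2; rewrite !ffunE.
pose m := GRing.isLinear.Build F _ _ _ _ lin.
pose ev : {linear {ffun 'I_(grN M) -> M} -> M} :=
  HB.pack (fun p : {ffun 'I_(grN M) -> M} => p s) m.
have evE q : linfun ev q = q s by rewrite lfunE.
rewrite -evE memv_preim; apply: subvP pG; apply: vspan_sub => q qG.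
by rewrite -memv_preim evE.
Qed.

Lemma gr_act_grc X p : gr_act (M := M) X p \in gr_space M.
Proof. by apply/gr_spaceP => s; rewrite ffunE cls_grc. Qed.

Lemma gr_act_linear X : linear (gr_act (M := M) X).
Proof.
move=> c p q; apply/ffunP=> s; rewrite !ffunE -linearP scaler_sumr -big_split /=.
by congr (cls _ _ _); apply: eq_bigr => r _; rewrite !ffunE linearP.
Qed.

Lemma gr_actE X (p : gr M) : vsval (pact (gr M) X p) = gr_act X (vsval p).
Proof.
have lin : linear (fun p : gr M => vsproj (gr_space M) (gr_act X (vsval p))).
  by move=> c q q'; rewrite linearP gr_act_linear linearP.
pose m := GRing.isLinear.Build F _ _ _ _ lin.
pose f : {linear gr M -> gr M} :=
  HB.pack (fun p : gr M => vsproj (gr_space M) (gr_act X (vsval p))) m.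
by rewrite /= (lfunE f) /= vsprojK ?gr_act_grc.
Qed.

Lemma grP (p q : gr M) : (forall s, vsval p s = vsval q s) -> p = q.
Proof. by move=> pq; apply: val_inj; apply/ffunP. Qed.

Lemma gr_mem (p : gr M) s : vsval p s \in fil M s.
Proof.
by apply: subvP (grc_fil s) _ _; have /gr_spaceP := subvsP p.
Qed.

Lemma big_ord_interval (V : nmodType) N r s (f : nat -> V) : (r <= s < N)%N ->
  \sum_(q < N | (r <= q <= s)%N) f q = \sum_(a < (s - r).+1) f (a + r)%N.
Proof.
case/andP=> rs sN; rewrite -[RHS](big_mkord xpredT (fun a => f (a + r)%N)).
rewrite -subSn // -(big_addn 0 s.+1 r xpredT f).
rewrite (big_nat_widen _ _ _ _ _ sN) (big_nat_widenl _ 0) // big_mkord.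
by apply: eq_bigl => q; rewrite /= ltnS andbC.
Qed.

Lemma gr_act2E X Y (p : gr M) (s : 'I_(grN M)) : \tr X = 0 -> \tr Y = 0 ->
  vsval (pact (gr M) X (pact (gr M) Y p)) s =
  cls M s (\sum_(r < grN M | (r <= s)%N) \sum_(a < (s - r).+1)
     pact M (coef_xt X (s - r - a)) (pact M (coef_xt Y a) (vsval p r))).
Proof.
move=> X0 Y0; rewrite !gr_actE ffunE linear_sum /=.
transitivity (cls M s (\sum_(q < grN M | (q <= s)%N) \sum_(r < grN M | (r <= q)%N)
    pact M (coef_xt X (s - q)) (pact M (coef_xt Y (q - r)) (vsval p r)))).
  rewrite linear_sum; apply: eq_bigr => q qs /=; rewrite ffunE.
  rewrite /coef_xt cls_act ?mxtrace_coef_mx ?subnKC //.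
    by rewrite linear_sum.
  apply: memv_suml => r rq; apply: fil_act (gr_mem p r).
    exact: mxtrace_coef_mx.
  by rewrite subnKC.
congr (cls _ _ _); rewrite (exchange_big_dep (fun r : 'I_(grN M) => (r <= s)%N)) /=; last first.
  by move=> q r qs rq; exact: leq_trans qs.
apply: eq_bigr => r rs.
transitivity (\sum_(q < grN M | (r <= q <= s)%N)
    pact M (coef_xt X (s - q)) (pact M (coef_xt Y (q - r)) (vsval p r))).
  by apply: eq_bigl => q; rewrite andbC.
rewrite (@big_ord_interval _ _ r s (fun q => pact M (coef_xt X (s - q))
   (pact M (coef_xt Y (q - r)) (vsval p r)))) ?rs ?ltn_ord //.
apply: eq_bigr => a _; congr (pact M (coef_xt X _) (pact M (coef_xt Y _) _)).
  by rewrite addnC subnDA.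
by rewrite addnK.
Qed.

Lemma gr_rep : sl2_rep (pact (gr M)).
Proof.
split=> [c X Y X0 Y0|X Y X0 Y0]; apply/lfunP=> p; apply: grP => s.
  rewrite add_lfunE scale_lfunE !linearD !linearZ /= !gr_actE !ffunE.
  rewrite -linearP scaler_sumr -big_split; congr (cls _ _ _); apply: eq_bigr => r _ /=.
  rewrite -scale_lfunE -add_lfunE -sl2_repZD ?mxtrace_xt ?mxtrace_coef_mx //.
  by rewrite /coef_xt -xtZD -coef_mxZD.
rewrite add_lfunE opp_lfunE !comp_lfunE linearB /= ffunE [in RHS]ffunE.
rewrite !gr_act2E // gr_actE ffunE -linearB /= -sumrB; congr (cls _ _ _).
apply: eq_bigr => r rs.
(* Reversing the second sum makes [X] act in degree $s-r-a$ and [Y] in degree $a$ in both sums. *)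
rewrite [X in _ = _ - X](reindex_inj rev_ord_inj) -sumrB coef_xtJ sl2_rep_sum //.
  rewrite sum_lfunE; apply: eq_bigr => a _.
  rewrite sl2_repJ ?mxtrace_xt ?mxtrace_coef_mx // add_lfunE opp_lfunE !comp_lfunE.
  by rewrite /= subSS subKn // -ltnS.
by move=> a; rewrite raddfB /= mxtrace_mulC subrr.
Qed.

(* Modulo the annihilator P, t^k is a combination of lower powers of t. *)
Lemma gr_kill (P : {poly F}) (d : nat) : P \is monic -> size P = d.+1 ->
  (forall X, \tr X = 0 -> (forall l k, P %| X l k) -> pact M X = 0) ->
  forall X, \tr X = 0 -> (forall l k, 'X^d %| X l k) -> pact (gr M) X = 0.
Proof.
move=> Pm sP kill X X0 dvd; apply/lfunP=> p; apply: grP => s.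
rewrite zero_lfunE gr_actE !ffunE; apply/eqP.
have low x k r w : \tr x = 0 -> (d <= k)%N -> (r + k <= s)%N -> w \in fil M r ->
    pact M (xt x k) w \in filp M s.
  (* Since [P] is monic of degree $d$, the leading terms cancel in [R]. It acts as $t^k$ does but
     has degree below $k$, hence $x_k w \in F_{r+k-1}$. *)
  move=> x0 dk rk wF; pose R := 'X^k - 'X^(k - d) * P.
  have sR : (size R <= k)%N.
    apply/leq_sizeP => j; rewrite leq_eqVlt => /predU1P[<-|kj]; rewrite coefB coefXn coefXnM.
      rewrite eqxx ltnNge leq_subr /= subKn //.
      by have /eqP := monicP Pm; rewrite lead_coefE sP => /eqP ->; rewrite subrr.
    rewrite gtn_eqF // ltnNge (leq_trans (leq_subr _ _) (ltnW kj)) /=.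
    by rewrite [P`_ _]nth_default ?subrr // sP; lia.
  have -> : xt x k = ('X^(k - d) * P) *: map_mx polyC x +
       \sum_(l < k) (R`_l)%:A *: xt x l.
    have -> : \sum_(l < k) (R`_l)%:A *: xt x l = R *: map_mx polyC x.
      have RE : R = \sum_(l < k) R`_l *: 'X^l.
        rewrite -poly_def; apply/polyP=> j; rewrite coef_poly.
        by case: ltnP => // kj; rewrite nth_default // (leq_trans sR).
      rewrite [in RHS]RE scaler_suml; apply: eq_bigr => l _.
      by apply/matrixP=> a b; rewrite !mxE mulr_algl scalerAl.
    by rewrite /xt -scalerDl addrC subrK.
  have tx (q : {poly F}) : \tr (q *: map_mx polyC x) = 0.
    by rewrite mxtraceZ trace_map_mx x0 rmorph0 mulr0.
  have tl (l : 'I_k) : \tr ((R`_l)%:A *: xt x l) = 0.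
    by rewrite mxtraceZ mxtrace_xt ?mulr0.
  rewrite sl2_repD ?sl2_rep_sum ?tx //; last by rewrite raddf_sum big1 // => l _; exact: tl.
  rewrite add_lfunE kill ?tx // => [|l h]; last by rewrite !mxE dvdp_mulr // dvdp_mulIr.
  rewrite zero_lfunE add0r sum_lfunE; apply: memv_suml => l _.
  rewrite sl2_repZ ?mxtrace_xt // scale_lfunE memvZ //.
  apply: subvP (fil_act x0 (leqnn _) wF); apply: filp_lt.
  by have := ltn_ord l; lia.
have sF : \sum_(r < grN M | (r <= s)%N) pact M (coef_xt X (s - r)) (vsval p r)
    \in filp M s; last by rewrite cls_eq0 // (subvP (filp_fil s)).
apply: memv_suml => r rs; have [dk|kd] := leqP d (s - r).
  by apply: low dk _ (gr_mem p r); rewrite ?subnKC ?mxtrace_coef_mx.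
have -> : coef_xt X (s - r) = 0.
  apply/matrixP=> l h; rewrite !mxE; have /dvdpP[q ->] := dvd l h.
  by rewrite coefMXn kd polyC0 mulr0.
by rewrite sl2_rep0 // zero_lfunE mem0v.
Qed.

(** The generator sits in degree $0$. For $s>0$ the degree $s$ part of [X] sends it to a multiple of
    itself, which lies in $F_0 \subseteq F_{s-1}$ and so has class $0$ in degree $s$; only the
    scalar from degree $0$ survives. *)
Lemma gr_lowest : lowest (pact M) (pgen M) -> lowest (pact (gr M)) (pgen (gr M)).
Proof.
move=> low X X0 X01.
have lowc s : exists c, pact M (coef_xt X s) (pgen M) = c *: pgen M.
  apply/vlineP; apply: low; first by rewrite mxtrace_xt ?mxtrace_coef_mx.
  by rewrite !mxE X01 coef0 polyC0 mulr0.
have genE (s : 'I_(grN M)) : vsval (pgen (gr M)) s =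
    if s == 0%N :> nat then cls M 0 (pgen M) else 0.
  rewrite vsprojK ?ffunE //; apply/gr_spaceP => t; rewrite ffunE.
  by case: eqP => [->|_]; rewrite ?cls_grc ?mem0v.
have [c cE] := lowc 0%N; apply/vlineP; exists c; apply: grP => s.
rewrite linearZ /= ffunE genE gr_actE ffunE.
rewrite (bigD1 ord0) //= big1 => [|r /andP[_ r0]]; last first.
  by rewrite genE (negPf (r0 : r != 0%N :> nat)) linear0.
rewrite addr0 subn0 genE /= cls_act ?fil_gen ?mxtrace_coef_mx //.
have [s0|s0] := eqVneq (s : nat) 0%N; first by rewrite s0 cE linearZ.
have [e ->] := lowc s; rewrite linearZ scaler0 /=.
have /eqP -> : cls M s (pgen M) == 0; last by rewrite scaler0.
have gF : pgen M \in filp M s by apply: subvP fil_gen; apply: filp_lt; rewrite lt0n.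
by rewrite cls_eq0 // (subvP (filp_fil _)).
Qed.

End Graded.

(** * Fusion products *)

Section Fusion.
Variables (F : fieldType).
Implicit Types (A : seq nat) (z : seq F).

Lemma fusion_rep A z : sl2_rep (pact (fusion A z)).
Proof. exact: gr_rep (evprod_rep _). Qed.

Lemma fusion_lowest A z : lowest (pact (fusion A z)) (pgen (fusion A z)).
Proof. exact: gr_lowest (evprod_lowest _). Qed.

Definition killed (V : vectType F) (rho : 'M[{poly F}]_2 -> 'End(V)) (d : nat) :=
  forall X, \tr X = 0 -> (forall l k, 'X^d %| X l k) -> rho X = 0.

(** Before grading, the tensor product is killed by $\prod_i(t-z_i)$, monic of degree $n$; passing
    to the graded module leaves its leading term $t^n$. *)
Lemma fusion_killed A z : size z = size A -> killed (pact (fusion A z)) (size A).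
Proof.
move=> szA; have szP : size (map snd (zip A z)) = size A.
  by rewrite size_map size_zip szA minnn.
apply: (gr_kill (evprod_rep _) (P := \prod_(c <- map snd (zip A z)) ('X - c%:P))).
- exact: monic_prod_XsubC.
- by rewrite size_prod_XsubC szP.
- by move=> X _; rewrite big_map; exact: evprod_kill.
Qed.

(** For $i=n-1$ and $a_n=a_i$ one has $A''=(1)$. There $e^{(2)}_0$ is zero, which is compatible with
    $u^2=0$. *)
Lemma fusion1_killed (c : F) : killed (pact (fusion [:: 1%N] [:: c])) 0.
Proof.
apply: (gr_kill (evprod_rep _) (P := 1)); rewrite ?monic1 ?size_poly1 // => X _ _.
exact: evprod1_kill.
Qed.

End Fusion.

(** * Restriction along maps that are multiplicative modulo $t^d$ *)

Section Killed.
Variables (F : fieldType) (V : vectType F) (rho : 'M[{poly F}]_2 -> 'End(V)).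
Variable d : nat.
Hypotheses (rep : sl2_rep rho) (kill : killed rho d).

Lemma killed_congr X Y : \tr X = 0 -> \tr Y = 0 ->
  (forall l k, 'X^d %| X l k - Y l k) -> rho X = rho Y.
Proof.
move=> X0 Y0 dvd; have XY0 : \tr (X - Y) = 0 by rewrite raddfB /= X0 Y0 subrr.
rewrite -[X](subrK Y) sl2_repD // kill ?add0r // => l k.
by rewrite !mxE.
Qed.

Lemma killed_sl2e (p p' : {poly F}) : 'X^d %| p - p' -> rho (sl2e p) = rho (sl2e p').
Proof.
move=> dvd; apply: killed_congr; rewrite ?mxtrace_sl2e // => l k.
by rewrite !mxE -mulrBl dvdp_mulr.
Qed.

Variables (B : comAlgType F) (f : {linear B -> {poly F}}).
Hypothesis fM : forall x y, 'X^d %| f (x * y) - f x * f y.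

Lemma mxtrace_map_linear (X : 'M[B]_2) : \tr X = 0 -> \tr (map_mx f X) = 0.
Proof. move=> X0; rewrite -(raddf0 f) -X0 raddf_sum.
by apply: eq_bigr => l _; rewrite mxE. Qed.

(** As [rho] does not see multiples of $t^d$, a linear map into $F[t]$ that is multiplicative modulo
    $t^d$ serves as well as an algebra morphism. *)
Lemma killed_pullback : sl2_rep (fun X => rho (map_mx f X)).
Proof.
split=> [c X Y X0 Y0|X Y X0 Y0].
  rewrite -sl2_repZD ?mxtrace_map_linear //; congr rho.
  by apply/matrixP=> l k; rewrite !mxE raddfD /= !mulr_algl linearZ.
rewrite -sl2_repJ ?mxtrace_map_linear //; apply: killed_congr => [||l k].
- by rewrite mxtrace_map_linear // raddfB /= mxtrace_mulC subrr.
- by rewrite raddfB /= mxtrace_mulC subrr.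
rewrite !mxE raddfB /= 2!(raddf_sum f) -!sumrB.
apply: (big_ind (fun p => 'X^d %| p)) => [|p p' dp dp'|h _].
- exact: dvdp0.
- exact: dvdp_add.
rewrite !mxE /= opprD addrACA -opprD.
by apply: dvdp_sub; rewrite ?opprK fM.
Qed.

Lemma linear_exp_congr (t : B) j :
  f 1 = 1 -> 'X^d %| f t - 'X -> 'X^d %| f (t ^+ j) - 'X^j.
Proof.
move=> f1 ft; elim: j => [|j IH]; first by rewrite !expr0 f1 subrr dvdp0.
have -> : f (t ^+ j.+1) - 'X^(j.+1) =
    (f (t * t ^+ j) - f t * f (t ^+ j)) + (f t - 'X) * f (t ^+ j)
    + 'X * (f (t ^+ j) - 'X^j).
  by rewrite !exprS; ring.
apply: dvdp_add; last exact: dvdp_mull.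
by apply: dvdp_add; [exact: fM|exact: dvdp_mulr].
Qed.

End Killed.

(** * Transport of the action to $S$ *)

Section Transport.
Variables (F : fieldType) (B : comAlgType F) (S T : vectType F).
Variables (rho : 'M[B]_2 -> 'End(T)) (v : T) (ops : 'End(T) -> Prop).
Variable iota : 'Hom(S, T).
Hypotheses (rep : sl2_rep rho) (low : lowest rho v).
Hypothesis opsE : forall g, ops g -> exists b, g = rho (sl2e b).
Hypothesis stabE :
  forall b w, w \in opspan ops v -> rho (sl2e b) w \in opspan ops v.
Hypotheses (inj : lker iota = 0%VS) (im : limg iota = opspan ops v).

(** By [opspan_stable] the image of [iota] is a submodule, so conjugation by the injective map
    [iota] carries the action back to [S]. *)
Lemma cyclic_transport : exists rhoS : 'M[B]_2 -> 'End(S),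
  [/\ sl2_rep rhoS,
      forall X s, \tr X = 0 -> iota (rhoS X s) = rho X (iota s) &
      exists2 s, iota s = v & cyclic_vector rhoS s].
Proof.
have iinj : injective iota by apply/lker0P/eqP.
pose rhoS X := (iota^-1 \o rho X \o iota)%VF.
have E X s : \tr X = 0 -> iota (rhoS X s) = rho X (iota s).
  move=> X0; rewrite /rhoS !comp_lfunE /= limg_lfunVK // im.
  by apply: opspan_stable => //; rewrite -im memv_img ?memvf.
have vim : v \in limg iota by rewrite im opspan_gen.
clearbody rhoS; exists rhoS; split=> //.
- split=> [c X Y X0 Y0|X Y X0 Y0]; apply/lfunP=> s; apply: iinj.
    have Z0 : \tr (c%:A *: X + Y) = 0 by rewrite mxtraceD mxtraceZ X0 Y0 mulr0 addr0.
    rewrite E // sl2_repZD //.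
    by rewrite !add_lfunE !scale_lfunE [RHS]linearP /= !E.
  rewrite E ?sl2_repJ //; last by rewrite raddfB /= mxtrace_mulC subrr.
  by rewrite !add_lfunE !opp_lfunE !comp_lfunE [RHS]linearB /= !E.
exists (iota^-1%VF v); first by rewrite limg_lfunVK.
(* The image of the submodule [C] generated by the preimage of [v] contains [v] and is stable under
   [ops]. It therefore contains the whole image of [iota], and injectivity puts [s] in [C]. *)
apply/eqP; rewrite eqEsubv subvf /=; apply/subvP=> s _; set C := opspan _ _.
have sub : (opspan ops v <= iota @: C)%VS.
  apply: opspan_sub => [|g w og].
    by rewrite -(limg_lfunVK vim) memv_img ?opspan_gen.
  case/memv_imgP=> s' s'C ->; have [b ->] := opsE og.
  rewrite -E ?mxtrace_sl2e // memv_img //; apply: opspan_closed s'C.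
  by exists (sl2e b) => //; exact: mxtrace_sl2e.
have : iota s \in (iota @: C)%VS by rewrite (subvP sub) // -im memv_img ?memvf.
by case/memv_imgP=> s' s'C /iinj ->.
Qed.

End Transport.

(** * The action on the tensor product *)

Section Truncation.
Variable F : fieldType.

Lemma mk_monicXn m : (0 < m)%N -> mk_monic ('X^m : {poly F}) = 'X^m.
Proof. by move=> m0; rewrite /mk_monic monicXn size_polyXn ltnS m0. Qed.

Lemma rmodpXn m (p : {poly F}) : (0 < m)%N ->
  'X^m %| Pdiv.Ring.rmodp p (mk_monic 'X^m) - p.
Proof.
move=> m0; rewrite mk_monicXn // [X in _ - X](Pdiv.RingMonic.rdivp_eq (monicXn F m)).
by rewrite opprD addrCA subrr addr0 -mulNr dvdp_mull.
Qed.

Lemma in_qpolyXn m (p : {poly F}) : (0 < m)%N ->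
  'X^m %| (in_qpoly 'X^m p : {poly F}) - p.
Proof. exact: rmodpXn. Qed.

Lemma qpolyXnM m (p q : {poly %/ ('X^m : {poly F})}) : (0 < m)%N ->
  'X^m %| ((p * q : {poly %/ ('X^m : {poly F})}) : {poly F}) - (p : {poly F}) * (q : {poly F}).
Proof. by move=> m0; rewrite poly_of_qpolyM rmodpXn. Qed.

Lemma size_qpolyXn m (p : {poly %/ ('X^m : {poly F})}) : (0 < m)%N ->
  (size (p : {poly F}) <= m)%N.
Proof.
by move=> m0; apply: leq_trans (size_npoly p) _; rewrite mk_monicXn // size_polyXn.
Qed.

Lemma dvdX_coef0B (p : {poly F}) : 'X %| (p`_0)%:P - p.
Proof. by rewrite -['X]subr0 dvdp_XsubCl rootE !hornerE horner_coef0 subrr. Qed.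

(** Multiplicativity modulo $t^e$ of the map sending $p + au$ to $p + at^r$, where [c] and [c'] are
    the constant terms of [p] and [p']. The defect splits into four terms; in the mixed ones
    $t^r(c-p)$ is divisible by $t^{r+1}$, hence by $t^e$. *)
Lemma square_zero_congr (q : bool) e r (s p p' : {poly F}) (a b c c' : F) :
  (e <= r.+1)%N -> 'X^e %| ('X^r *+ q - 'X^r * 'X^r : {poly F}) ->
  'X^e %| s - p * p' -> 'X %| c%:P - p -> 'X %| c'%:P - p' ->
  'X^e %| s + (c * b + a * c' + (a * b) *+ q) *: 'X^r -
          (p + a *: 'X^r) * (p' + b *: 'X^r).
Proof.
move=> er Xq spp cp cp'.
have Xr h : 'X %| h -> 'X^e %| 'X^r * h.
  by move=> Xh; apply: dvdp_trans (dvdp_mul (dvdpp _) Xh); rewrite -exprSr dvdp_exp2l.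
have -> : s + (c * b + a * c' + (a * b) *+ q) *: 'X^r -
    (p + a *: 'X^r) * (p' + b *: 'X^r) = (s - p * p') + b%:P * ('X^r * (c%:P - p))
    + a%:P * ('X^r * (c'%:P - p')) + (a * b)%:P * ('X^r *+ q - 'X^r * 'X^r).
  by rewrite -!mul_polyC; case: q {Xq}; rewrite ?mulr1n ?mulr0n; ring.
by do 3?[apply: dvdp_add] => //; apply: dvdp_mull => //; apply: Xr.
Qed.

End Truncation.

(** * The cyclic module structure for $i=1$ and for $i\ge2$ *)

Section Cyclic.
Variables (F : fieldType) (M N : pmod F) (d e r : nat).
Hypotheses (repM : sl2_rep (pact M)) (repN : sl2_rep (pact N)).
Hypotheses (lowM : lowest (pact M) (pgen M)) (lowN : lowest (pact N) (pgen N)).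
Hypotheses (killM : killed (pact M) d) (killN : killed (pact N) e).

Lemma eop_sum (U : {vspace tens M N}) m (p : {poly F}) w :
  (size p <= m)%N -> (forall j, (j < m)%N -> eop M N j w \in U) ->
  pact (tens M N) (sl2e p) w \in U.
Proof.
move=> sp H; have -> : sl2e p = \sum_(j < m) (p`_j)%:A *: sl2e 'X^j.
  have {1}-> : p = \sum_(j < m) p`_j *: 'X^j.
    rewrite -poly_def; apply/polyP=> j; rewrite coef_poly.
    by case: ltnP => // mj; rewrite nth_default // (leq_trans sp).
  rewrite /sl2e scaler_suml; apply: eq_bigr => j _.
  by rewrite scalerA mulr_algl.
have repT : sl2_rep (pact (tens M N)) by exact: tensor_rep.
rewrite sl2_rep_sum // => [|j]; last by rewrite mxtraceZ mxtrace_sl2e mulr0.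
rewrite sum_lfunE; apply: memv_suml => j _.
by rewrite sl2_repZ ?mxtrace_sl2e // scale_lfunE memvZ // H.
Qed.

Section Pair.
Variables (B : comAlgType F) (f g : {linear B -> {poly F}}).
Hypothesis fM : forall x y, 'X^d %| f (x * y) - f x * f y.
Hypothesis gM : forall x y, 'X^e %| g (x * y) - g x * g y.

(** Two maps are kept because $u$ must act as $0$ on [M] and as $t^r$ on [N]. *)
Definition pair_act := tensor_act (fun X => pact M (map_mx f X))
                                  (fun X => pact N (map_mx g X)).

Lemma pair_rep : sl2_rep pair_act.
Proof. by apply: tensor_rep; [exact: killed_pullback fM|exact: killed_pullback gM]. Qed.

Lemma pair_lowest : lowest pair_act (pgen (tens M N)).
Proof.
by apply: tensor_lowest => X X0 X01; [apply: lowM|apply: lowN];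
  rewrite ?mxtrace_map_linear // mxE X01 raddf0.
Qed.

Lemma map_sl2e (h : {linear B -> {poly F}}) b : map_mx h (sl2e b) = sl2e (h b).
Proof.
apply/matrixP=> l k; rewrite !mxE; case: andP => _; rewrite ?mulr1 ?mulr0 ?raddf0 //.
Qed.

Lemma pair_eop t j : f 1 = 1 -> g 1 = 1 -> 'X^d %| f t - 'X -> 'X^e %| g t - 'X ->
  pair_act (sl2e (t ^+ j)) = eop M N j.
Proof.
move=> f1 g1 ft gt; rewrite /pair_act /tensor_act !map_sl2e.
rewrite (killed_sl2e repM killM (linear_exp_congr fM j f1 ft)).
by rewrite (killed_sl2e repN killN (linear_exp_congr gM j g1 gt)).
Qed.

End Pair.

Variables (S : vectType F) (iota : 'Hom(S, tens M N)) (m : nat).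
Let ops (h : 'End(tens M N)) :=
  (exists2 j : nat, (j < m)%N & h = eop M N j) \/ h = eop2 M N r.
Hypotheses (inj : lker iota = 0%VS) (im : limg iota = opspan ops (pgen (tens M N))).

(** $e_d$ is zero on [M], so only its action on the second factor remains. *)
Lemma eop_top : eop M N d = eop2 M N d.
Proof.
apply: tensf_add0; apply: killM; rewrite ?mxtrace_sl2e // => l k.
by rewrite !mxE dvdp_mulr.
Qed.

(** The case $i=1$, with $d=r=n-2$ and $e=n-1$. A class of $F[t]/(t^{m+1})$ acts through its
    representative of degree at most $m$, which is multiplicative modulo $t^{m+1}$, hence modulo
    $t^d$ and $t^e$. *)
Lemma cyclic_trunc (q : bool) : d = m -> r = m -> (e <= m.+1)%N ->
  exists rho : 'M[Bkm F q 0 m]_2 -> 'End(S),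
    [/\ sl2_rep rho,
        forall j s, iota (rho (sl2e (tB F q 0 m ^+ j)) s) = eop M N j (iota s) &
        exists2 s, iota s = pgen (tens M N) & cyclic_vector rho s].
Proof.
move=> dm rm em; rewrite /Bkm /tB.
pose v (p : {poly %/ ('X^(m.+1) : {poly F})}) : {poly F} := p.
have lin : linear v by [].
pose mix := GRing.isLinear.Build F _ _ _ _ lin.
pose f : {linear {poly %/ ('X^(m.+1) : {poly F})} -> {poly F}} := HB.pack v mix.
have fM c : (c <= m.+1)%N -> forall x y, 'X^c %| f (x * y) - f x * f y.
  by move=> cm x y; apply: dvdp_trans (qpolyXnM x y _); rewrite ?dvdp_exp2l.
have ft c : (c <= m.+1)%N -> 'X^c %| f (in_qpoly 'X^(m.+1) 'X) - 'X.
  by move=> cm; apply: dvdp_trans (in_qpolyXn 'X _); rewrite ?dvdp_exp2l.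
have dm1 : (d <= m.+1)%N by rewrite dm.
have tE j : pair_act f f (sl2e (in_qpoly 'X^(m.+1) 'X ^+ j)) = eop M N j.
  by apply: pair_eop; [exact: fM|exact: fM| | |exact: ft|exact: ft].
(* The generator $e^{(2)}_{n-2}$ of the image is the action of $e\otimes t^m$, the one power of $t$
   missing from the list $e_0,\ldots,e_{n-3}$. *)
have topE : eop2 M N r = eop M N m by rewrite rm -dm eop_top.
have [||h opsh|b w wU|rho [rep rhoE cyc]] :=
  cyclic_transport (rho := pair_act f f) _ _ _ _ inj im.
- by apply: pair_rep; apply: fM.
- exact: pair_lowest.
- case: opsh => [[j _ ->]|->]; first by exists (in_qpoly 'X^(m.+1) 'X ^+ j).
  by exists (in_qpoly 'X^(m.+1) 'X ^+ m); rewrite tE.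
- have -> : pair_act f f (sl2e b) = pact (tens M N) (sl2e (f b)).
    by rewrite /pair_act /tensor_act !map_sl2e.
  apply: (@eop_sum _ m.+1) => [|j]; first exact: size_qpolyXn.
  rewrite ltnS leq_eqVlt => /predU1P[->|jm]; apply: opspan_closed => //.
    by right; rewrite topE.
  by left; exists j.
by exists rho; split=> // j s; rewrite rhoE ?mxtrace_sl2e // tE.
Qed.

(** The case $i\ge2$, with $d=m=n-2$ and $r=n-i-1$. The map for [M] forgets $u$ and the one for [N]
    sends $u$ to $t^r$. On [N], $tu=0$ holds because $e\le r+1$, and the divisibility hypothesis is
    the relation $u^2=qu$. *)
Lemma cyclic_ext (q : bool) (k : nat) : (0 < m)%N -> d = m -> (e <= m)%N -> (e <= r.+1)%N ->
  'X^e %| ('X^r *+ q - 'X^r * 'X^r : {poly F}) ->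
  exists rho : 'M[Bkm F q k.+1 m]_2 -> 'End(S),
    [/\ sl2_rep rho,
        forall j s, iota (rho (sl2e (tB F q k.+1 m ^+ j)) s) = eop M N j (iota s),
        forall s, iota (rho (sl2e (uB F q k.+1 m)) s) = eop2 M N r (iota s) &
        exists2 s, iota s = pgen (tens M N) & cyclic_vector rho s].
Proof.
move=> m0 dm em er Xq; rewrite /Bkm /tB /uB.
pose v1 (x : balg F q m) : {poly F} := x.1.
pose v2 (x : balg F q m) : {poly F} := (x.1 : {poly F}) + x.2 *: 'X^r.
have lin1 : linear v1 by [].
have lin2 : linear v2.
  move=> c x y; rewrite /v2 /= scalerDr scalerDl !scalerA.
  by rewrite addrACA.
pose mix1 := GRing.isLinear.Build F _ _ _ _ lin1.
pose mix2 := GRing.isLinear.Build F _ _ _ _ lin2.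
pose f : {linear balg F q m -> {poly F}} := HB.pack v1 mix1.
pose g : {linear balg F q m -> {poly F}} := HB.pack v2 mix2.
have fE x : f x = x.1 by [].
have gE x : g x = (x.1 : {poly F}) + x.2 *: 'X^r by [].
clearbody f g; clear v1 v2 lin1 lin2 mix1 mix2.
have fM x y : 'X^d %| f (x * y) - f x * f y by rewrite dm !fE; exact: qpolyXnM.
have gM x y : 'X^e %| g (x * y) - g x * g y.
  rewrite !gE; apply: square_zero_congr => //; [|exact: dvdX_coef0B|exact: dvdX_coef0B].
  by apply: dvdp_trans (qpolyXnM _ _ m0); rewrite dvdp_exp2l.
pose t : balg F q m := (in_qpoly 'X^m 'X, 0); pose u : balg F q m := (0, 1).
have tE j : pair_act f g (sl2e (t ^+ j)) = eop M N j.
  apply: pair_eop; [exact: fM|exact: gM| | | |]; rewrite ?fE ?gE /=.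
  - by [].
  - by rewrite scale0r addr0.
  - by rewrite dm in_qpolyXn.
  - by rewrite scale0r addr0; apply: dvdp_trans (in_qpolyXn _ m0); rewrite dvdp_exp2l.
(* $e\otimes(p+cu)$ acts as $e\otimes p$ on both factors plus $c\,e^{(2)}_r$, so stability under
   raising operators follows from that under the listed generators. *)
have pE (b : balg F q m) : pair_act f g (sl2e b) =
    pact (tens M N) (sl2e (b.1 : {poly F})) + b.2 *: eop2 M N r.
  apply: tens_ext => x y; rewrite [RHS]add_lfunE scale_lfunE !tensor_actE !map_sl2e fE gE.
  rewrite tensfE id_lfunE -addrA -tensvZr -tensvDr; congr (_ + tensv _ _).
  rewrite -scale_lfunE -add_lfunE; congr (fun_of_lfun _ _).
  rewrite [LHS](_ : _ = pact N (b.2%:A *: sl2e 'X^r + sl2e (b.1 : {poly F}))); last first.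
    by congr (pact N _); rewrite /sl2e scalerA -scalerDl mulr_algl addrC.
  by rewrite sl2_repZD ?mxtrace_sl2e // addrC.
have uE : pair_act f g (sl2e u) = eop2 M N r.
  have repT : sl2_rep (pact (tens M N)) by exact: tensor_rep.
  by rewrite (pE u) scale1r /sl2e scale0r sl2_rep0 ?add0r.
have [||h opsh|b w wU|rho [rep rhoE cyc]] :=
  cyclic_transport (rho := pair_act f g) _ _ _ _ inj im.
- by apply: pair_rep.
- exact: pair_lowest.
- by case: opsh => [[j _ ->]|->]; [exists (t ^+ j)|exists u].
- rewrite pE add_lfunE scale_lfunE memvD ?memvZ //; last first.
    by apply: opspan_closed => //; right.
  apply: (@eop_sum _ m) => [|j jm]; first exact: size_qpolyXn.
  by apply: opspan_closed => //; left; exists j.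
by exists rho; split=> [//|j s|s|//]; rewrite rhoE ?mxtrace_sl2e // ?tE ?uE.
Qed.

End Cyclic.

(** Serves both pairs of sequences in the theorem, which share the lengths $n-2$ and $n-i$. The last
    hypothesis selects, for $i\ge2$, the relation $u^2=qu$ that $t^{n-i-1}$ satisfies on the second
    factor. *)
Lemma fusion_cyclic (F : fieldType) (q : bool) (n i : nat) (A1 A2 : seq nat)
    (z1 z2 : seq F) (S : vectType F)
    (iota : 'Hom(S, tens (fusion A1 z1) (fusion A2 z2))) :
  (2 <= n)%N -> (1 <= i <= n - 1)%N ->
  size A1 = (n - 2)%N -> size A2 = (n - i)%N ->
  points A1 z1 -> points A2 z2 -> embedding n i iota ->
  ((2 <= i)%N -> q = (i == n - 1)%N \/ [/\ q = false, i = (n - 1)%N & A2 = [:: 1%N]]) ->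
  cyclic_Lmod q n i iota.
Proof.
move=> n2 /andP[i1 iN] sA1 sA2 [sz1 _] [sz2 _] [inj im] Hq.
have killM := fusion_killed sz1; have killN := fusion_killed sz2.
rewrite sA1 in killM; rewrite sA2 in killN.
have [repM repN] := (fusion_rep A1 z1, fusion_rep A2 z2).
have [lowM lowN] := (@fusion_lowest _ A1 z1, @fusion_lowest _ A2 z2).
rewrite /cyclic_Lmod; case: i i1 iN sA2 im Hq killN => [|[|i]] // _ iN sA2 im Hq killN.
  have [||rho [rep tE cyc]] :=
    cyclic_trunc repM repN lowM lowN killM killN inj im q erefl; [lia|lia|].
  by exists rho.
(* $t^e$ kills the second factor: $e=n-i$ by its length, or $e=0$ when that factor is trivial. *)
have [e [em er eX killN']] : exists e,
   [/\ (e <= n - 2)%N, (e <= (n - i.+2 - 1).+1)%N,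
    'X^e %| ('X^(n - i.+2 - 1) *+ q - 'X^(n - i.+2 - 1) * 'X^(n - i.+2 - 1) : {poly F}) &
    killed (pact (fusion A2 z2)) e].
  have [qE|[_ _ A21]] := Hq isT; last first.
    exists 0%N; split=> //; first by rewrite expr0 dvd1p.
    rewrite A21 in sz2 *; case: z2 sz2 {iota inj im killN repN lowN} => [|c [|]] // _.
    exact: fusion1_killed.
  exists (n - i.+2)%N; split=> //; [lia|lia|].
  (* For $i=n-1$ the exponent $r=n-i-1$ is $0$ and $t^0=1$ is idempotent. Otherwise $r\ge1$, so
     $e=r+1\le 2r$ and $t^{2r}$ is zero modulo $t^e$. *)
  rewrite qE; case: eqP => [iE|iE].
    have -> : (n - i.+2 - 1)%N = 0%N by lia.
    by rewrite expr0 mulr1 subrr dvdp0.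
  by rewrite mulr0n sub0r dvdpNr -exprD dvdp_exp2l //; lia.
have m0 : (0 < n - 2)%N by lia.
have [rho [rep tE uE cyc]] :=
  cyclic_ext repM repN lowM lowN killM killN' inj im i m0 erefl em er eX.
by exists rho.
Qed.

Theorem lemma2p6 (R : realType) (n i : nat) (A : seq nat)
    (z zS : seq (complex R))
    (phi : 'Hom(fusion A z, fusion (seqS i A) zS)) :
  (2 <= n)%N -> size A = n -> sorted leq A -> (2 <= ent A 1)%N ->
  (1 <= i <= n - 1)%N ->
  points A z -> points (seqS i A) zS ->
  pmod_hom phi -> limg phi = fullv ->
  phi (pgen (fusion A z)) = pgen (fusion (seqS i A) zS) ->
  let S : vectType (complex R) := subvs_of (lker phi) in
  (forall (z1 z2 : seq (complex R))
      (iota : 'Hom(S, tens (fusion (seqL i A) z1) (fusion (seqR i A) z2))),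
    points (seqL i A) z1 -> points (seqR i A) z2 -> embedding n i iota ->
    cyclic_Lmod (degenerate n i A) n i iota)
  /\
  (sorted ltn A ->
   (forall j, (i < j < n)%N -> (1 < ent A j.+1 - ent A j)%N) ->
   forall (z1 z2 : seq (complex R))
      (iota : 'Hom(S, tens (fusion (seqL1 i A) z1) (fusion (seqR2 i A) z2))),
    points (seqL1 i A) z1 -> points (seqR2 i A) z2 -> embedding n i iota ->
    cyclic_Lmod (degenerate n i A) n i iota).
Proof.
move=> n2 sA _ _ hi _ _ _ _ _ S.
have st : size (take i.-1 A) = i.-1 by rewrite size_take sA; case: ltnP; lia.
split=> [|Alt _] z1 z2 iota p1 p2 emb; apply: fusion_cyclic emb _ => //.
- by rewrite size_cat st size_nseq sA; lia.
- by rewrite size_map size_drop sA.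
- move=> i2; rewrite /degenerate; have -> : (2 < n)%N by lia.
  case: eqP => [iE|_]; last by left.
  have En : n = i.+1 by lia.
  case: ltnP => /= [_|ge]; first by left.
  (* Here $i=n-1$ and $a_n\le a_i$: the truncated difference $a_n-a_i$ is $0$, so $A''=(1)$. *)
  right; split=> //; rewrite /seqR.
  have -> : drop i A = [:: ent A n].
    rewrite (drop_nth 0) ?sA ?En //; congr (_ :: _); apply: size0nil.
    by rewrite size_drop sA En subnn.
  by rewrite /= (eqP ge).
- by rewrite size_cat st size_iota sA; lia.
- by rewrite size_map size_iota sA.
- move=> i2; left; rewrite /degenerate; have -> : (2 < n)%N by lia.
  case: eqP => [iE|_] //=.
  have -> : n = i.+1 by lia.
  (* Strict monotonicity gives $a_{n-1}<a_n$, so for $i=n-1$ the case is always degenerate. *)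
  rewrite /ent /=; have := @sorted_ltn_nth _ ltn ltn_trans 0%N A Alt i.-1 i.
  by apply; rewrite ?inE; lia.
Qed.
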